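(* Over $\mathbf{ZF}$, the following statements are equivalent: (i) The Principle of Dependent Choices, $\mathbf{DC}$. (ii) For any $\omega$-chain of viable problems $\langle P_n:n\in\mathbb{N}\rangle$ (where, for all $n\in\mathbb{N}$, $P_n=(I_n,S_n,\sigma_n)$ and $S_n=I_{n+1}$) and for every instance $z\in I_0$, there is a solution sequence $\langle z_n:n\in\mathbb{N}\rangle$ for this $\omega$-chain with $z_0=z$. (iii) Every $\omega$-chain of viable problems has a solution sequence.
   Context: The base theory is $\mathbf{ZF}$ (no choice is assumed). The Principle of Dependent Choices $\mathbf{DC}$ asserts: if $\delta\subseteq A\times A$ is a binary relation on a non-empty set $A$ satisfying $(\forall x\in A)(\exists y\in A)[x\,\delta\,y]$, then there is a sequence $\langle x_n:n\in\mathbb{N}\rangle$ of elements of $A$ such that $x_n\,\delta\,x_{n+1}$ for all $n\in\mathbb{N}$. Let $\{I_n:n\in\mathbb{N}\}$ be a family of non-empty sets and $\{\sigma_n:n\in\mathbb{N}\}$ a family of binary relations such that $\sigma_n\subseteq I_n\times I_{n+1}$ for all $n\in\mathbb{N}$. Let $S_n=I_{n+1}$ and $P_n=(I_n,S_n,\sigma_n)$ for all $n\in\mathbb{N}$. Then $\langle P_n:n\in\mathbb{N}\rangle$ is an $\omega$-chain of viable problems if all the problems $P_n$ are viable, i.e. for all $n\in\mathbb{N}$, $(\forall z\in I_n)(\exists s\in S_n)[z\,\sigma_n\,s]$. A solution sequence for an $\omega$-chain of viable problems $\langle P_n:n\in\mathbb{N}\rangle$ is a sequence $\langle z_n:n\in\mathbb{N}\rangle$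 such that $z_n\in I_n$ and $z_n\,\sigma_n\,z_{n+1}$ for all $n\in\mathbb{N}$. *)

(* Defs.v *)
(** ** Structures for the language of set theory *)

Record set_structure := SetStructure {
  carrier :> Type;
  mem : carrier -> carrier -> Prop
}.

Declare Scope zf_scope.
Delimit Scope zf_scope with zf.
Notation "x ∈ y" := (mem _ x y) (at level 70, no associativity) : zf_scope.
Open Scope zf_scope.

(** ** First-order formulas, in de Bruijn notation *)

Inductive formula : Type :=
| fMem (i j : nat)
| fEq (i j : nat)
| fFalse
| fAnd (p q : formula)
| fOr (p q : formula)
| fImp (p q : formula)
| fAll (p : formula)
| fEx (p : formula).

Definition push {T : Type} (x : T) (rho : nat -> T) (n : nat) : T :=
  match n with O => x | S k => rho k end.

Fixpoint sat {M : set_structure} (rho : nat -> M) (p : formula) : Prop :=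
  match p with
  | fMem i j => rho i ∈ rho j
  | fEq i j => rho i = rho j
  | fFalse => False
  | fAnd p q => sat rho p /\ sat rho q
  | fOr p q => sat rho p \/ sat rho q
  | fImp p q => sat rho p -> sat rho q
  | fAll p => forall x : M, sat (push x rho) p
  | fEx p => exists x : M, sat (push x rho) p
  end.

(** ** Set-theoretic vocabulary, relative to a structure

    All quantifiers below range over the carrier of the structure, so each of
    these predicates is expressed by a first-order formula in [mem]. *)

Definition is_empty {M : set_structure} (x : M) : Prop :=
  forall z : M, ~ z ∈ x.

Definition is_nonempty {M : set_structure} (x : M) : Prop :=
  exists z : M, z ∈ x.

Definition is_upair {M : set_structure} (p a b : M) : Prop :=
  forall z : M, z ∈ p <-> z = a \/ z = b.

(** Kuratowski pairs: [p = {{a}, {a, b}}]. *)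
Definition is_opair {M : set_structure} (p a b : M) : Prop :=
  forall z : M, z ∈ p <-> is_upair z a a \/ is_upair z a b.

Definition is_triple {M : set_structure} (t a b c : M) : Prop :=
  exists q : M, is_opair q a b /\ is_opair t q c.

Definition is_succ {M : set_structure} (s x : M) : Prop :=
  forall z : M, z ∈ s <-> z ∈ x \/ z = x.

Definition is_inductive {M : set_structure} (w : M) : Prop :=
  (exists o : M, is_empty o /\ o ∈ w) /\
  (forall x : M, x ∈ w -> exists s : M, is_succ s x /\ s ∈ w).

(** Membership in the least inductive set of the structure. These are the
    natural numbers in the sense of [M], which need not be standard. *)
Definition is_nat {M : set_structure} (n : M) : Prop :=
  forall w : M, is_inductive w -> n ∈ w.

(** [related r x y] is [x r y]; for a function [f], [related f x y] is
    [f x = y]. *)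
Definition related {M : set_structure} (r x y : M) : Prop :=
  exists p : M, is_opair p x y /\ p ∈ r.

Definition is_relation_between {M : set_structure} (r a b : M) : Prop :=
  forall p : M, p ∈ r ->
    exists x y : M, x ∈ a /\ y ∈ b /\ is_opair p x y.

(** A set that is a function whose domain is the set of natural numbers. *)
Definition is_sequence {M : set_structure} (f : M) : Prop :=
  (forall p : M, p ∈ f -> exists n x : M, is_nat n /\ is_opair p n x) /\
  (forall n : M, is_nat n -> exists! x : M, related f n x).

(** ** The axioms of ZF *)

Definition extensionality (M : set_structure) : Prop :=
  forall x y : M, (forall z : M, z ∈ x <-> z ∈ y) -> x = y.

Definition foundation (M : set_structure) : Prop :=
  forall x : M, is_nonempty x ->
    exists y : M, y ∈ x /\ ~ (exists z : M, z ∈ y /\ z ∈ x).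

Definition pairing (M : set_structure) : Prop :=
  forall a b : M, exists p : M, is_upair p a b.

Definition union (M : set_structure) : Prop :=
  forall x : M, exists u : M,
    forall z : M, z ∈ u <-> exists y : M, y ∈ x /\ z ∈ y.

Definition powerset (M : set_structure) : Prop :=
  forall x : M, exists p : M,
    forall y : M, y ∈ p <-> (forall z : M, z ∈ y -> z ∈ x).

Definition infinity (M : set_structure) : Prop :=
  exists w : M, is_inductive w.

(** In the two schemas the assignment [rho] supplies the parameters. *)
Definition separation (M : set_structure) : Prop :=
  forall (p : formula) (rho : nat -> M) (a : M), exists b : M,
    forall x : M, x ∈ b <-> x ∈ a /\ sat (push x rho) p.

Definition replacement (M : set_structure) : Prop :=
  forall (p : formula) (rho : nat -> M) (a : M),
    (forall x y y' : M, x ∈ a ->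
      sat (push y (push x rho)) p -> sat (push y' (push x rho)) p -> y = y') ->
    exists b : M, forall y : M,
      y ∈ b <-> exists x : M, x ∈ a /\ sat (push y (push x rho)) p.

Definition models_ZF (M : set_structure) : Prop :=
  extensionality M /\ foundation M /\ pairing M /\ union M /\ powerset M /\
  infinity M /\ separation M /\ replacement M.

(** ** Dependent choices *)

Definition DC (M : set_structure) : Prop :=
  forall A delta : M,
    is_nonempty A ->
    is_relation_between delta A A ->
    (forall x : M, x ∈ A -> exists y : M, y ∈ A /\ related delta x y) ->
    exists f : M, is_sequence f /\
      (forall n x : M, is_nat n -> related f n x -> x ∈ A) /\
      (forall n m x y : M, is_nat n -> is_succ m n ->
         related f n x -> related f m y -> related delta x y).

(** ** Omega-chains of viable problems *)

(** [(i, s, sigma)] is a problem with set of instances [i], set of solutions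
    [s] and relation [sigma]. *)
Definition is_viable {M : set_structure} (i s sigma : M) : Prop :=
  forall z : M, z ∈ i -> exists u : M, u ∈ s /\ related sigma z u.

(** [P_n = (i, s, sigma)]. *)
Definition nth_problem {M : set_structure} (P n i s sigma : M) : Prop :=
  exists t : M, related P n t /\ is_triple t i s sigma.

Definition is_viable_chain {M : set_structure} (P : M) : Prop :=
  is_sequence P /\
  (forall n : M, is_nat n -> exists i s sigma : M,
     nth_problem P n i s sigma /\ is_nonempty i /\
     is_relation_between sigma i s /\ is_viable i s sigma) /\
  (forall n m i s sigma i' s' sigma' : M, is_nat n -> is_succ m n ->
     nth_problem P n i s sigma -> nth_problem P m i' s' sigma' -> s = i').

Definition is_solution_sequence {M : set_structure} (P f : M) : Prop :=
  is_sequence f /\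
  (forall n i s sigma x : M, is_nat n ->
     nth_problem P n i s sigma -> related f n x -> x ∈ i) /\
  (forall n m i s sigma x y : M, is_nat n -> is_succ m n ->
     nth_problem P n i s sigma -> related f n x -> related f m y ->
     related sigma x y).

Definition chains_solvable_from_each_instance (M : set_structure) : Prop :=
  forall P : M, is_viable_chain P ->
    forall o i s sigma z : M,
      is_empty o -> nth_problem P o i s sigma -> z ∈ i ->
      exists f : M, is_solution_sequence P f /\ related f o z.

Definition chains_solvable (M : set_structure) : Prop :=
  forall P : M, is_viable_chain P ->
    exists f : M, is_solution_sequence P f.

(* Main.v *)
Require Import Defs.
From Stdlib Require Import Setoid.

(** The theorem is proved as a cycle: dependent choices gives solutions from
    each instance, which gives solutions, which gives dependent choices. The
    second step is immediate because [I_0] is inhabited. For the third, a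
    relation [delta] on [A] is viewed as the constant chain [(A, A, delta)],
    whose solution sequences are exactly the sequences that dependent choices
    asks for.

    The first step is the substantial one, since dependent choices gives no
    control over where its sequence starts. It is therefore not applied to
    instances but to the finite partial solutions that start at the given
    [z], a set [A] on which [s delta t] means that [t] contains [s] and is
    defined at [n + 1] whenever [s] is defined at [n]. Viability extends every
    partial solution by one value at the successor of its last index
    ([partial_solution_extends]). If [f] is a [delta]-sequence, then [n] is in
    the domain of [f n] by induction on [n], so the diagonal [n |-> (f n) n]
    is total. It is single-valued because each [f n] is, and its steps are
    correct because its values at [n] and [n + 1] both lie in [f (n + 1)].
    Taking the diagonal instead of the union of the [f n] makes it unnecessary
    to compare natural numbers of the model. A partial solution is accordingly
    described by successors alone, and all that is needed about successors is
    that they are injective and free of fixed points, which is a consequence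
    of foundation.

    Since separation and replacement are schemas over formulas, each property
    used to form a set needs a formula. The formulas below repeat the
    definitions of the properties with de Bruijn indices for the arguments, so
    that [sat] of such a formula is the property itself by computation. *)

(** * Definable properties *)

Definition definable {M : set_structure} (phi : M -> Prop) : Prop :=
  exists p rho, forall x, sat (push x rho) p <-> phi x.

Definition definable2 {M : set_structure} (phi : M -> M -> Prop) : Prop :=
  exists p rho, forall x y, sat (push y (push x rho)) p <-> phi x y.

Definition fIff p q := fAnd (fImp p q) (fImp q p).
Definition fEmpty x := fAll (fImp (fMem 0 (S x)) fFalse).
Definition fUpair p a b :=
  fAll (fIff (fMem 0 (S p)) (fOr (fEq 0 (S a)) (fEq 0 (S b)))).
Definition fOpair p a b :=
  fAll (fIff (fMem 0 (S p)) (fOr (fUpair 0 (S a) (S a)) (fUpair 0 (S a) (S b)))).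
Definition fTriple t a b c :=
  fEx (fAnd (fOpair 0 (S a) (S b)) (fOpair (S t) 0 (S c))).
Definition fSucc s x :=
  fAll (fIff (fMem 0 (S s)) (fOr (fMem 0 (S x)) (fEq 0 (S x)))).
Definition fInductive w :=
  fAnd (fEx (fAnd (fEmpty 0) (fMem 0 (S w))))
       (fAll (fImp (fMem 0 (S w)) (fEx (fAnd (fSucc 0 1) (fMem 0 (2 + w)))))).
Definition fNat n := fAll (fImp (fInductive 0) (fMem (S n) 0)).
Definition fRelated r x y :=
  fEx (fAnd (fOpair 0 (S x) (S y)) (fMem 0 (S r))).
Definition fProblem P n i s sigma :=
  fEx (fAnd (fRelated (S P) (S n) 0) (fTriple 0 (S i) (S s) (S sigma))).

(** * Elementary sets *)

Lemma definable_separation {M : set_structure} (hM : models_ZF M)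
    (phi : M -> Prop) (a : M) :
  definable phi -> exists b : M, forall x, x ∈ b <-> x ∈ a /\ phi x.
Proof.
  destruct hM as (_ & _ & _ & _ & _ & _ & sep & _).
  intros (p & rho & E). destruct (sep p rho a) as [b Hb].
  exists b. intro x. rewrite Hb, E. reflexivity.
Qed.

Lemma definable_replacement {M : set_structure} (hM : models_ZF M)
    (phi : M -> M -> Prop) (a : M) :
  definable2 phi ->
  (forall x y y', x ∈ a -> phi x y -> phi x y' -> y = y') ->
  exists b : M, forall y, y ∈ b <-> exists x, x ∈ a /\ phi x y.
Proof.
  destruct hM as (_ & _ & _ & _ & _ & _ & _ & rep).
  intros (p & rho & E) fn. destruct (rep p rho a) as [b Hb].
  - intros x y y' Hx H H'. apply E in H. apply E in H'. eauto.
  - exists b. intro y. rewrite Hb.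
    split; intros (x & Hx & H); exists x; (split; [exact Hx|]); now apply E.
Qed.

Lemma eq_of_members {M : set_structure} (hM : models_ZF M)
    (phi : M -> Prop) (a b : M) :
  (forall z, z ∈ a <-> phi z) -> (forall z, z ∈ b <-> phi z) -> a = b.
Proof.
  destruct hM as (ext & _). intros Ha Hb. apply ext. intro z.
  rewrite Ha, Hb. reflexivity.
Qed.

Lemma empty_unique {M : set_structure} (hM : models_ZF M) (o o' : M) :
  is_empty o -> is_empty o' -> o = o'.
Proof.
  intros H H'. apply (eq_of_members hM (fun _ => False)); intro z.
  - specialize (H z). tauto.
  - specialize (H' z). tauto.
Qed.

Lemma succ_unique {M : set_structure} (hM : models_ZF M) (x s s' : M) :
  is_succ s x -> is_succ s' x -> s = s'.
Proof. exact (eq_of_members hM (fun z => z ∈ x \/ z = x) s s'). Qed.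

Lemma empty_not_succ {M : set_structure} (s x : M) :
  is_empty s -> is_succ s x -> False.
Proof. intros H S. apply (H x). apply S. now right. Qed.

Lemma upair_exists {M : set_structure} (hM : models_ZF M) (a b : M) :
  exists p : M, is_upair p a b.
Proof. now apply hM. Qed.

Lemma binary_union_exists {M : set_structure} (hM : models_ZF M) (a b : M) :
  exists u : M, forall z, z ∈ u <-> z ∈ a \/ z ∈ b.
Proof.
  destruct (upair_exists hM a b) as [p Hp].
  destruct hM as (_ & _ & _ & un & _). destruct (un p) as [u Hu].
  exists u. intro z. rewrite Hu. split.
  - intros (y & Hy & Hz). apply Hp in Hy. destruct Hy; subst; auto.
  - intros [H | H]; [exists a | exists b]; (split; [apply Hp; auto | exact H]).
Qed.

Lemma adjoin_exists {M : set_structure} (hM : models_ZF M) (a x : M) :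
  exists u : M, forall z, z ∈ u <-> z ∈ a \/ z = x.
Proof.
  destruct (upair_exists hM x x) as [p Hp].
  destruct (binary_union_exists hM a p) as [u Hu].
  exists u. intro z. rewrite Hu, (Hp z). tauto.
Qed.

Lemma succ_exists {M : set_structure} (hM : models_ZF M) (x : M) :
  exists s : M, is_succ s x.
Proof. exact (adjoin_exists hM x x). Qed.

Lemma mem_irreflexive {M : set_structure} (hM : models_ZF M) (x : M) : ~ x ∈ x.
Proof.
  intro Hx. destruct (upair_exists hM x x) as [p Hp].
  destruct hM as (_ & fnd & _). destruct (fnd p) as (y & Hy & N).
  - exists x. apply Hp. auto.
  - apply Hp in Hy. apply N. exists x.
    split; [destruct Hy; subst; exact Hx | apply Hp; auto].
Qed.

Lemma mem_asymmetric {M : set_structure} (hM : models_ZF M) (x y : M) :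
  x ∈ y -> ~ y ∈ x.
Proof.
  intros Hxy Hyx. destruct (upair_exists hM x y) as [p Hp].
  destruct hM as (_ & fnd & _). destruct (fnd p) as (z & Hz & N).
  - exists x. apply Hp. auto.
  - apply Hp in Hz. apply N. destruct Hz; subst.
    + exists y. split; [exact Hyx | apply Hp; auto].
    + exists x. split; [exact Hxy | apply Hp; auto].
Qed.

(** If [x ∪ {x} = y ∪ {y}] with [x] and [y] distinct, then each is a member
    of the other. *)
Lemma succ_injective {M : set_structure} (hM : models_ZF M) (s x y : M) :
  is_succ s x -> is_succ s y -> x = y.
Proof.
  intros Hx Hy.
  assert (Hxs : x ∈ s) by (apply Hx; auto).
  assert (Hys : y ∈ s) by (apply Hy; auto).
  apply Hy in Hxs. apply Hx in Hys.
  destruct Hxs as [Hxy | E]; [|exact E].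
  destruct Hys as [Hyx | E]; [|now symmetry].
  destruct (mem_asymmetric hM x y Hxy Hyx).
Qed.

Lemma succ_no_fixpoint {M : set_structure} (hM : models_ZF M) (x : M) :
  ~ is_succ x x.
Proof. intro H. apply (mem_irreflexive hM x). apply H. auto. Qed.

(** * Ordered pairs and products *)

Lemma opair_exists {M : set_structure} (hM : models_ZF M) (a b : M) :
  exists p : M, is_opair p a b.
Proof.
  destruct (upair_exists hM a a) as [u Hu].
  destruct (upair_exists hM a b) as [v Hv].
  destruct (upair_exists hM u v) as [p Hp].
  exists p. intro z. rewrite (Hp z). split.
  - intros [-> | ->]; auto.
  - intros [H | H]; [left | right].
    + exact (eq_of_members hM _ _ _ H Hu).
    + exact (eq_of_members hM _ _ _ H Hv).
Qed.

Lemma opair_unique {M : set_structure} (hM : models_ZF M) (a b p q : M) :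
  is_opair p a b -> is_opair q a b -> p = q.
Proof. exact (eq_of_members hM _ p q). Qed.

Lemma opair_injective {M : set_structure} (hM : models_ZF M) (p a b a' b' : M) :
  is_opair p a b -> is_opair p a' b' -> a = a' /\ b = b'.
Proof.
  assert (first : forall a b a' b' : M,
            is_opair p a b -> is_opair p a' b' -> a' = a).
  { clear a b a' b'. intros a b a' b' H H'.
    destruct (upair_exists hM a a) as [u Hu].
    assert (Hup : u ∈ p) by (apply H; auto).
    assert (Ha' : a' ∈ u)
      by (apply H' in Hup; destruct Hup as [K | K]; apply K; auto).
    apply Hu in Ha'. tauto. }
  assert (second : forall a b b' : M,
            is_opair p a b -> is_opair p a b' -> b = a \/ b = b').
  { clear a b a' b'. intros a b b' H H'.
    destruct (upair_exists hM a b) as [v Hv].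
    assert (Hvp : v ∈ p) by (apply H; auto).
    assert (Hb : b ∈ v) by (apply Hv; auto).
    apply H' in Hvp. destruct Hvp as [K | K]; apply K in Hb; tauto. }
  intros H H'. pose proof (first _ _ _ _ H H'). subst a'. split; [reflexivity|].
  destruct (second _ _ _ H H') as [E | E], (second _ _ _ H' H) as [E' | E'];
    congruence.
Qed.

Lemma triple_exists {M : set_structure} (hM : models_ZF M) (a b c : M) :
  exists t : M, is_triple t a b c.
Proof.
  destruct (opair_exists hM a b) as [q Hq].
  destruct (opair_exists hM q c) as [t Ht].
  now exists t, q.
Qed.

Lemma triple_injective {M : set_structure} (hM : models_ZF M)
    (t a b c a' b' c' : M) :
  is_triple t a b c -> is_triple t a' b' c' -> a = a' /\ b = b' /\ c = c'.
Proof.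
  intros (q & Hq & Ht) (q' & Hq' & Ht').
  destruct (opair_injective hM _ _ _ _ _ Ht Ht') as [<- <-].
  destruct (opair_injective hM _ _ _ _ _ Hq Hq') as [<- <-]. auto.
Qed.

(** A Kuratowski pair of elements of [a ∪ b] is a subset of the powerset of
    [a ∪ b], so the product can be separated from the second powerset. *)
Lemma product_exists {M : set_structure} (hM : models_ZF M) (a b : M) :
  exists c : M, forall p,
    p ∈ c <-> exists x y, x ∈ a /\ y ∈ b /\ is_opair p x y.
Proof.
  destruct (binary_union_exists hM a b) as [u Hu].
  assert (pow : powerset M) by apply hM.
  destruct (pow u) as [v Hv]. destruct (pow v) as [w Hw].
  destruct (definable_separation hM
    (fun p => exists x y, x ∈ a /\ y ∈ b /\ is_opair p x y) w) as [c Hc].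
  { exists (fEx (fEx (fAnd (fMem 1 3) (fAnd (fMem 0 4) (fOpair 2 1 0))))),
      (push a (push b (fun _ => a))). reflexivity. }
  exists c. intro p. rewrite Hc. split; [tauto|].
  intros (x & y & Hx & Hy & Hp). split; [|now exists x, y].
  apply Hw. intros q Hq. apply Hv. intros z Hz. apply Hu.
  apply Hp in Hq. destruct Hq as [K | K]; apply K in Hz;
    destruct Hz; subst; auto.
Qed.

Lemma related_iff_mem {M : set_structure} (hM : models_ZF M) (r p x y : M) :
  is_opair p x y -> (related r x y <-> p ∈ r).
Proof.
  intro Hp. split.
  - intros (q & Hq & Hr). now rewrite (opair_unique hM _ _ _ _ Hp Hq).
  - intro Hr. now exists p.
Qed.

(** The relation [s ∪ {(a, b)}]; it also provides singleton relations, with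
    [s] empty. *)
Lemma adjoin_related_exists {M : set_structure} (hM : models_ZF M)
    (s a b : M) :
  exists t : M,
    (forall p, p ∈ t <-> p ∈ s \/ is_opair p a b) /\
    (forall x y, related t x y <-> related s x y \/ (x = a /\ y = b)).
Proof.
  destruct (opair_exists hM a b) as [q Hq].
  destruct (adjoin_exists hM s q) as [t Ht].
  assert (Ht' : forall p, p ∈ t <-> p ∈ s \/ is_opair p a b).
  { intro p. rewrite Ht. split; (intros [H | H]; [now left | right]).
    - now subst.
    - exact (opair_unique hM _ _ _ _ H Hq). }
  exists t. split; [exact Ht'|]. intros x y. split.
  - intros (p & Hp & H). apply Ht' in H. destruct H as [H | H].
    + left. now exists p.
    + right. exact (opair_injective hM _ _ _ _ _ Hp H).
  - intros [(p & Hp & H) | [-> ->]].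
    + exists p. split; [exact Hp | apply Ht'; auto].
    + exists q. split; [exact Hq | apply Ht'; auto].
Qed.

(** * The natural numbers of the model *)

Lemma omega_exists {M : set_structure} (hM : models_ZF M) :
  exists w : M, forall n, n ∈ w <-> is_nat n.
Proof.
  assert (inf : infinity M) by apply hM. destruct inf as [w0 Hw0].
  destruct (definable_separation hM is_nat w0) as [w Hw].
  { exists (fNat 0), (fun _ => w0). reflexivity. }
  exists w. intro n. rewrite Hw. split; [tauto|]. intro H.
  split; [exact (H w0 Hw0) | exact H].
Qed.

Lemma nat_empty {M : set_structure} (hM : models_ZF M) (o : M) :
  is_empty o -> is_nat o.
Proof.
  intros Ho w ((o' & Ho' & Hw) & _). now rewrite (empty_unique hM _ _ Ho Ho').
Qed.

Lemma nat_succ {M : set_structure} (hM : models_ZF M) (n m : M) :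
  is_nat n -> is_succ m n -> is_nat m.
Proof.
  intros Hn Hm w Hw. destruct (proj2 Hw n (Hn w Hw)) as (m' & Hm' & H).
  now rewrite (succ_unique hM _ _ _ Hm Hm').
Qed.

Lemma empty_exists {M : set_structure} (hM : models_ZF M) :
  exists o : M, is_empty o.
Proof.
  assert (inf : infinity M) by apply hM.
  destruct inf as (w & (o & Ho & _) & _). now exists o.
Qed.

Lemma nat_induction {M : set_structure} (hM : models_ZF M) (phi : M -> Prop) :
  definable phi ->
  (forall o, is_empty o -> phi o) ->
  (forall n m, is_nat n -> is_succ m n -> phi n -> phi m) ->
  forall n, is_nat n -> phi n.
Proof.
  intros D H0 HS n Hn.
  destruct (omega_exists hM) as [w Hw].
  destruct (definable_separation hM phi w D) as [v Hv].
  apply (Hv n). apply Hn. split.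
  - destruct (empty_exists hM) as [o Ho]. exists o. split; [exact Ho|].
    apply Hv. split; [apply Hw; now apply (nat_empty hM) | auto].
  - intros k Hk. apply Hv in Hk. destruct Hk as [Hk Pk]. apply Hw in Hk.
    destruct (succ_exists hM k) as [m Hm]. exists m. split; [exact Hm|].
    apply Hv. split; [apply Hw; exact (nat_succ hM _ _ Hk Hm) | eauto].
Qed.

(** * Chains of problems *)

Lemma nth_problem_unique {M : set_structure} (hM : models_ZF M)
    (P n i s sigma i' s' sigma' : M) :
  is_sequence P -> is_nat n ->
  nth_problem P n i s sigma -> nth_problem P n i' s' sigma' ->
  i = i' /\ s = s' /\ sigma = sigma'.
Proof.
  intros [_ fn] Hn (t & Ht & T) (t' & Ht' & T').
  destruct (fn n Hn) as (u & _ & Hu).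
  rewrite <- (Hu t Ht) in *. rewrite <- (Hu t' Ht') in *.
  exact (triple_injective hM _ _ _ _ _ _ _ T T').
Qed.

Definition is_instance {M : set_structure} (P n x : M) : Prop :=
  exists i s sigma, nth_problem P n i s sigma /\ x ∈ i.

Definition is_step {M : set_structure} (P n x y : M) : Prop :=
  exists i s sigma, nth_problem P n i s sigma /\ related sigma x y.

Definition fInstance P n x :=
  fEx (fEx (fEx (fAnd (fProblem (3 + P) (3 + n) 2 1 0) (fMem (3 + x) 2)))).
Definition fStep P n x y :=
  fEx (fEx (fEx (fAnd (fProblem (3 + P) (3 + n) 2 1 0)
                      (fRelated 0 (3 + x) (3 + y))))).

Lemma instances_exists {M : set_structure} (hM : models_ZF M) (P : M) :
  is_sequence P ->
  exists U : M, forall n x, is_nat n -> is_instance P n x -> x ∈ U.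
Proof.
  intro HP. destruct (omega_exists hM) as [w Hw].
  destruct (definable_replacement hM
    (fun n i => exists s sigma, nth_problem P n i s sigma) w) as [I HI].
  { exists (fEx (fEx (fProblem 4 3 2 1 0))), (push P (fun _ => P)).
    reflexivity. }
  { intros n i i' Hn (s & sigma & H) (s' & sigma' & H'). apply Hw in Hn.
    now destruct (nth_problem_unique hM _ _ _ _ _ _ _ _ HP Hn H H'). }
  assert (un : union M) by apply hM. destruct (un I) as [U HU].
  exists U. intros n x Hn (i & s & sigma & H & Hx). apply HU.
  exists i. split; [|exact Hx]. apply HI. exists n. split; [now apply Hw|].
  now exists s, sigma.
Qed.

Lemma viable_step {M : set_structure} (hM : models_ZF M) (P n m x : M) :
  is_viable_chain P -> is_nat n -> is_succ m n -> is_instance P n x ->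
  exists y, is_step P n x y /\ is_instance P m y.
Proof.
  intros (HP & V & L) Hn Hm (i & s & sigma & H & Hx).
  destruct (V n Hn) as (i' & s' & sigma' & H' & _ & _ & via).
  destruct (nth_problem_unique hM _ _ _ _ _ _ _ _ HP Hn H H')
    as (<- & <- & <-).
  destruct (via x Hx) as (y & Hy & R). exists y. split.
  - now exists i, s, sigma.
  - destruct (V m (nat_succ hM _ _ Hn Hm)) as (j & t & tau & K & _).
    exists j, t, tau. split; [exact K|].
    now rewrite <- (L _ _ _ _ _ _ _ _ Hn Hm H K).
Qed.

(** * Finite partial solutions *)

Definition in_domain {M : set_structure} (s n : M) : Prop :=
  exists x, related s n x.

(** The last index of [s]. *)
Definition is_top {M : set_structure} (s n : M) : Prop :=
  in_domain s n /\
  (forall k, in_domain s k -> k = n \/ exists m, is_succ m k /\ in_domain s m) /\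
  (forall m, is_succ m n -> ~ in_domain s m).

(** The domain is an initial segment [{0, ..., n}], described without the
    order of the natural numbers: it contains 0, it is closed under
    predecessors, and [n] is its only element whose successor is missing. *)
Definition is_partial_solution {M : set_structure} (P z s : M) : Prop :=
  (forall p, p ∈ s -> exists n x, is_nat n /\ is_opair p n x /\ is_instance P n x) /\
  (forall n x x', related s n x -> related s n x' -> x = x') /\
  (forall o, is_empty o -> related s o z) /\
  (forall n m x y, is_succ m n -> related s n x -> related s m y -> is_step P n x y) /\
  (forall n m, is_succ m n -> in_domain s m -> in_domain s n) /\
  (exists n, is_top s n).

Definition is_extension {M : set_structure} (s t : M) : Prop :=
  (forall p, p ∈ s -> p ∈ t) /\
  (forall n m, is_succ m n -> in_domain s n -> in_domain t m).

Definition fDomain s n := fEx (fRelated (S s) (S n) 0).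
Definition fTop s n :=
  fAnd (fDomain s n)
  (fAnd (fAll (fImp (fDomain (S s) 0)
     (fOr (fEq 0 (S n)) (fEx (fAnd (fSucc 0 1) (fDomain (2 + s) 0))))))
   (fAll (fImp (fSucc 0 (S n)) (fImp (fDomain (S s) 0) fFalse)))).
Definition fPartialSolution P z s :=
  fAnd (fAll (fImp (fMem 0 (S s))
     (fEx (fEx (fAnd (fNat 1) (fAnd (fOpair 2 1 0) (fInstance (3 + P) 1 0)))))))
  (fAnd (fAll (fAll (fAll (fImp (fRelated (3 + s) 2 1)
     (fImp (fRelated (3 + s) 2 0) (fEq 1 0))))))
  (fAnd (fAll (fImp (fEmpty 0) (fRelated (S s) 0 (S z))))
  (fAnd (fAll (fAll (fAll (fAll (fImp (fSucc 2 3)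
     (fImp (fRelated (4 + s) 3 1)
     (fImp (fRelated (4 + s) 2 0) (fStep (4 + P) 3 1 0))))))))
  (fAnd (fAll (fAll (fImp (fSucc 0 1)
     (fImp (fDomain (2 + s) 0) (fDomain (2 + s) 1)))))
   (fEx (fTop (S s) 0)))))).
Definition fExtension s t :=
  fAnd (fAll (fImp (fMem 0 (S s)) (fMem 0 (S t))))
   (fAll (fAll (fImp (fSucc 0 1) (fImp (fDomain (2 + s) 1) (fDomain (2 + t) 0))))).

Lemma partial_solution_related {M : set_structure} (hM : models_ZF M)
    (P z s n x : M) :
  is_partial_solution P z s -> related s n x -> is_nat n /\ is_instance P n x.
Proof.
  intros (H & _) (p & Hp & Hs). destruct (H p Hs) as (n' & x' & Hn & Hp' & Hi).
  destruct (opair_injective hM _ _ _ _ _ Hp Hp') as [-> ->]. auto.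
Qed.

Lemma initial_partial_solution {M : set_structure} (hM : models_ZF M)
    (P o z : M) :
  is_empty o -> is_instance P o z ->
  exists s, is_partial_solution P z s.
Proof.
  intros Ho Hz. destruct (adjoin_related_exists hM o o z) as (s & Hs & Hr).
  assert (Hr' : forall x y, related s x y <-> x = o /\ y = z).
  { intros x y. rewrite Hr. split; [|tauto].
    intros [(p & _ & Hp) | H]; [destruct (Ho p Hp) | exact H]. }
  assert (Hd : forall n, in_domain s n <-> n = o).
  { intro n. split.
    - intros [x Hx]. now apply Hr' in Hx.
    - intros ->. exists z. now apply Hr'. }
  exists s. split; [|split; [|split; [|split; [|split]]]].
  - intros p Hp. apply Hs in Hp. destruct Hp as [Hp | Hp].
    + destruct (Ho p Hp).
    + exists o, z. split; [exact (nat_empty hM o Ho) | auto].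
  - intros n x x' H H'. apply Hr' in H, H'. intuition congruence.
  - intros o' Ho'. apply Hr'. split; [|reflexivity].
    exact (empty_unique hM _ _ Ho' Ho).
  - intros n m x y Hm _ H. apply Hr' in H. destruct H as [-> _].
    destruct (empty_not_succ _ _ Ho Hm).
  - intros n m Hm H. apply Hd in H. subst m.
    destruct (empty_not_succ _ _ Ho Hm).
  - exists o. split; [now apply Hd|split].
    + intros k Hk. left. now apply Hd.
    + intros m Hm H. apply Hd in H. subst m.
      exact (empty_not_succ _ _ Ho Hm).
Qed.

(** Adjoin the pair of [m] and [y], where [m] is the successor of the last
    index [n] and [y] is a solution of the problem [P_n] for the last value. *)
Lemma partial_solution_extends {M : set_structure} (hM : models_ZF M)
    (P z s : M) :
  is_viable_chain P -> is_partial_solution P z s ->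
  exists t, is_partial_solution P z t /\ is_extension s t.
Proof.
  intros HP Hs. pose proof Hs as (H1 & H2 & H3 & H4 & H5 & n & Hn & Htop & Hlast).
  destruct Hn as [x Hx].
  destruct (partial_solution_related hM _ _ _ _ _ Hs Hx) as [Hnat Hinst].
  destruct (succ_exists hM n) as [m Hm]. specialize (Hlast m Hm).
  destruct (viable_step hM P n m x HP Hnat Hm Hinst) as (y & Hstep & Hy).
  destruct (adjoin_related_exists hM s m y) as (t & Ht & Hr).
  assert (Hd : forall k, in_domain t k <-> in_domain s k \/ k = m).
  { intro k. split.
    - intros [u Hu]. apply Hr in Hu. destruct Hu as [Hu | [-> _]]; [|auto].
      left. now exists u.
    - intros [[u Hu] | ->]; [exists u | exists y]; apply Hr; auto. }
  exists t. split; [split; [|split; [|split; [|split; [|split]]]]|split].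
  - intros p Hp. apply Ht in Hp. destruct Hp as [Hp | Hp]; [auto|].
    exists m, y. split; [exact (nat_succ hM _ _ Hnat Hm) | auto].
  - intros k u u' H H'. apply Hr in H, H'.
    destruct H as [H | [-> ->]], H' as [H' | [E ->]].
    + eauto.
    + subst k. destruct Hlast. now exists u.
    + destruct Hlast. now exists u'.
    + reflexivity.
  - intros o Ho. apply Hr. auto.
  - intros k l u v Hl Hu Hv. apply Hr in Hu, Hv.
    destruct Hu as [Hu | [-> ->]], Hv as [Hv | [E ->]].
    + eauto.
    + subst l. rewrite (succ_injective hM _ _ _ Hl Hm) in *.
      now rewrite (H2 _ _ _ Hu Hx).
    + destruct Hlast. apply (H5 m l Hl). now exists v.
    + subst l. destruct (succ_no_fixpoint hM m Hl).
  - intros k l Hl H. apply Hd in H. apply Hd. left.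
    destruct H as [H | ->]; [eauto|].
    rewrite (succ_injective hM _ _ _ Hl Hm). now exists x.
  - exists m. split; [apply Hd; auto|split].
    + intros k Hk. apply Hd in Hk. destruct Hk as [Hk | ->]; [|auto].
      right. destruct (Htop k Hk) as [-> | (l & Hl & H)].
      * exists m. split; [exact Hm | apply Hd; auto].
      * exists l. split; [exact Hl | apply Hd; auto].
    + intros l Hl H. apply Hd in H. destruct H as [H | ->].
      * exact (Hlast (H5 _ _ Hl H)).
      * exact (succ_no_fixpoint hM m Hl).
  - intros p Hp. apply Ht. auto.
  - intros k l Hl Hk. apply Hd. destruct (Htop k Hk) as [-> | (l' & Hl' & H)].
    + right. exact (succ_unique hM _ _ _ Hl Hm).
    + left. now rewrite (succ_unique hM _ _ _ Hl Hl').
Qed.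

Lemma partial_solutions_exists {M : set_structure} (hM : models_ZF M)
    (P z : M) :
  is_sequence P ->
  exists A : M, forall s, s ∈ A <-> is_partial_solution P z s.
Proof.
  intro HP. destruct (omega_exists hM) as [w Hw].
  destruct (instances_exists hM P HP) as [U HU].
  destruct (product_exists hM w U) as [c Hc].
  assert (pow : powerset M) by apply hM. destruct (pow c) as [d Hd].
  destruct (definable_separation hM (is_partial_solution P z) d) as [A HA].
  { exists (fPartialSolution 1 2 0), (push P (push z (fun _ => P))).
    reflexivity. }
  exists A. intro s. rewrite HA. split; [tauto|]. intro H.
  split; [|exact H]. apply Hd. intros p Hp. apply Hc.
  destruct (proj1 H p Hp) as (n & x & Hn & Hpx & Hx).
  exists n, x. split; [now apply Hw | eauto].
Qed.

Lemma extension_relation_exists {M : set_structure} (hM : models_ZF M)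
    (A : M) :
  exists delta : M,
    is_relation_between delta A A /\
    (forall s t, related delta s t <-> s ∈ A /\ t ∈ A /\ is_extension s t).
Proof.
  destruct (product_exists hM A A) as [c Hc].
  destruct (definable_separation hM
    (fun p => exists s t, is_opair p s t /\ is_extension s t) c) as [delta Hdl].
  { exists (fEx (fEx (fAnd (fOpair 2 1 0) (fExtension 1 0)))), (fun _ => A).
    reflexivity. }
  exists delta. split.
  - intros p Hp. apply Hdl in Hp. now apply Hc.
  - intros s t. destruct (opair_exists hM s t) as [p Hp].
    rewrite (related_iff_mem hM _ _ _ _ Hp), Hdl, Hc. split.
    + intros [(s' & t' & Hs & Ht & Hp') (s2 & t2 & Hp2 & E)].
      destruct (opair_injective hM _ _ _ _ _ Hp Hp') as [<- <-].
      destruct (opair_injective hM _ _ _ _ _ Hp Hp2) as [<- <-]. auto.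
    + intros (Hs & Ht & E). split; exists s, t; auto.
Qed.

(** * From partial solutions to solutions *)

Lemma diagonal_exists {M : set_structure} (hM : models_ZF M) (P z f : M) :
  is_sequence P ->
  (forall n s, is_nat n -> related f n s -> is_partial_solution P z s) ->
  exists g : M,
    (forall p, p ∈ g -> exists n x, is_nat n /\ is_opair p n x) /\
    (forall n x, related g n x <->
       is_nat n /\ exists s, related f n s /\ related s n x).
Proof.
  intros HP Hf. destruct (omega_exists hM) as [w Hw].
  destruct (instances_exists hM P HP) as [U HU].
  destruct (product_exists hM w U) as [c Hc].
  destruct (definable_separation hM
    (fun p => exists n x s, is_opair p n x /\ related f n s /\ related s n x) c)
    as [g Hg].
  { exists (fEx (fEx (fEx (fAnd (fOpair 3 2 1)
      (fAnd (fRelated 4 2 0) (fRelated 0 2 1)))))), (push f (fun _ => f)).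
    reflexivity. }
  exists g. split.
  - intros p Hp. apply Hg in Hp. destruct Hp as [Hp _]. apply Hc in Hp.
    destruct Hp as (n & x & Hn & _ & Hp). exists n, x.
    split; [now apply Hw | exact Hp].
  - intros n x. destruct (opair_exists hM n x) as [p Hp].
    rewrite (related_iff_mem hM _ _ _ _ Hp), Hg, Hc. split.
    + intros [(n1 & x1 & Hn & _ & Hp1) (n2 & x2 & s & Hp2 & Hs & Hx)].
      destruct (opair_injective hM _ _ _ _ _ Hp Hp1) as [<- <-].
      destruct (opair_injective hM _ _ _ _ _ Hp Hp2) as [<- <-].
      split; [now apply Hw | now exists s].
    + intros (Hn & s & Hs & Hx). split.
      * exists n, x. split; [now apply Hw|]. split; [|exact Hp].
        apply (HU n x Hn).
        exact (proj2 (partial_solution_related hM _ _ _ _ _ (Hf _ _ Hn Hs) Hx)).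
      * now exists n, x, s.
Qed.

Lemma chains_solvable_from_each_instance_of_DC {M : set_structure}
    (hM : models_ZF M) :
  DC M -> chains_solvable_from_each_instance M.
Proof.
  intros dc P HP o i s0 sigma0 z Ho H0 Hz.
  pose proof (proj1 HP) as Hseq.
  destruct (partial_solutions_exists hM P z Hseq) as [A HA].
  destruct (extension_relation_exists hM A) as (delta & Hbet & Hdl).
  destruct (dc A delta) as (f & Hf & HfA & Hfd).
  { destruct (initial_partial_solution hM P o z Ho) as [s Hs].
    - now exists i, s0, sigma0.
    - exists s. now apply HA. }
  { exact Hbet. }
  { intros s Hs. apply HA in Hs.
    destruct (partial_solution_extends hM P z s HP Hs) as (t & Ht & E).
    apply HA in Hs, Ht. exists t. split; [exact Ht | apply Hdl; auto]. }
  assert (Hpart : forall n s, is_nat n -> related f n s ->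
            is_partial_solution P z s) by (intros; apply HA; eauto).
  assert (Hext : forall n m s t, is_nat n -> is_succ m n ->
            related f n s -> related f m t -> is_extension s t)
    by (intros n m s t Hn Hm Hs Ht; now apply (Hdl s t); apply (Hfd n m)).
  assert (Hval : forall n, is_nat n -> exists s, related f n s).
  { intros n Hn. destruct (proj2 Hf n Hn) as (s & Hs & _). now exists s. }
  assert (Hdiag : forall n, is_nat n ->
            exists s, related f n s /\ in_domain s n).
  { apply (nat_induction hM).
    - exists (fEx (fAnd (fRelated 2 1 0) (fDomain 0 1))), (push f (fun _ => f)).
      reflexivity.
    - intros o' Ho'. pose proof (nat_empty hM o' Ho') as Hn.
      destruct (Hval o' Hn) as [s Hs]. exists s. split; [exact Hs|].
      exists z. now apply (Hpart o' s Hn Hs).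
    - intros n m Hn Hm (s & Hs & Hd).
      destruct (Hval m (nat_succ hM _ _ Hn Hm)) as [t Ht]. exists t.
      split; [exact Ht|]. exact (proj2 (Hext n m s t Hn Hm Hs Ht) n m Hm Hd). }
  destruct (diagonal_exists hM P z f Hseq Hpart) as (g & Hgp & Hg).
  exists g. split; [split; [split|split]|].
  - exact Hgp.
  - intros n Hn. destruct (Hdiag n Hn) as (s & Hs & x & Hx).
    exists x. split.
    + apply Hg. eauto.
    + intros x' Hx'. apply Hg in Hx'. destruct Hx' as (_ & s' & Hs' & Hx').
      destruct (proj2 Hf n Hn) as (u & _ & Hu).
      rewrite <- (Hu s' Hs'), (Hu s Hs) in Hx'.
      exact (proj1 (proj2 (Hpart n s Hn Hs)) n x x' Hx Hx').
  - intros n j s sigma x Hn Hj Hx. apply Hg in Hx.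
    destruct Hx as (_ & t & Ht & Hx).
    destruct (partial_solution_related hM _ _ _ _ _ (Hpart n t Hn Ht) Hx)
      as (_ & j' & s' & sigma' & Hj' & Hx').
    now destruct (nth_problem_unique hM _ _ _ _ _ _ _ _ Hseq Hn Hj Hj')
      as (-> & _).
  - intros n m j s sigma x y Hn Hm Hj Hx Hy. apply Hg in Hx, Hy.
    destruct Hx as (_ & t & Ht & Hx), Hy as (Hm' & t' & Ht' & Hy).
    (* Both values belong to the partial solution [t'] with index [m]. *)
    assert (Hx' : related t' n x).
    { destruct Hx as (p & Hp & Hpt). exists p. split; [exact Hp|].
      exact (proj1 (Hext n m t t' Hn Hm Ht Ht') p Hpt). }
    destruct (Hpart m t' Hm' Ht') as (_ & _ & _ & Hst & _).
    destruct (Hst n m x y Hm Hx' Hy) as (j' & s' & sigma' & Hj' & R).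
    now destruct (nth_problem_unique hM _ _ _ _ _ _ _ _ Hseq Hn Hj Hj')
      as (_ & _ & ->).
  - apply Hg. pose proof (nat_empty hM o Ho) as Hn. split; [exact Hn|].
    destruct (Hval o Hn) as [s Hs]. exists s. split; [exact Hs|].
    now apply (Hpart o s Hn Hs).
Qed.

(** * From solutions to dependent choices *)

Lemma chains_solvable_of_each_instance {M : set_structure} (hM : models_ZF M) :
  chains_solvable_from_each_instance M -> chains_solvable M.
Proof.
  intros H P HP. destruct (empty_exists hM) as [o Ho].
  destruct (proj1 (proj2 HP) o (nat_empty hM o Ho))
    as (i & s & sigma & Hi & [z Hz] & _).
  destruct (H P HP o i s sigma z Ho Hi Hz) as (f & Hf & _). now exists f.
Qed.

Lemma constant_sequence_exists {M : set_structure} (hM : models_ZF M) (t : M) :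
  exists P : M, is_sequence P /\
    forall n t', related P n t' <-> is_nat n /\ t' = t.
Proof.
  destruct (omega_exists hM) as [w Hw].
  destruct (upair_exists hM t t) as [u Hu].
  destruct (product_exists hM w u) as [P HP].
  assert (HR : forall n t', related P n t' <-> is_nat n /\ t' = t).
  { intros n t'. destruct (opair_exists hM n t') as [p Hp].
    rewrite (related_iff_mem hM _ _ _ _ Hp), HP. split.
    - intros (n' & t2 & Hn & Ht & Hp').
      destruct (opair_injective hM _ _ _ _ _ Hp Hp') as [<- <-].
      apply Hw in Hn. apply Hu in Ht. tauto.
    - intros [Hn ->]. exists n, t.
      split; [now apply Hw | split; [apply Hu; auto | exact Hp]]. }
  exists P. split; [split|exact HR].
  - intros p Hp. apply HP in Hp. destruct Hp as (n & x & Hn & _ & Hp).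
    exists n, x. split; [now apply Hw | exact Hp].
  - intros n Hn. exists t. split; [now apply HR|].
    intros t' Ht'. apply HR in Ht'. now symmetry.
Qed.

Lemma DC_of_chains_solvable {M : set_structure} (hM : models_ZF M) :
  chains_solvable M -> DC M.
Proof.
  intros H A delta HA Hbet Htot.
  destruct (triple_exists hM A A delta) as [t Ht].
  destruct (constant_sequence_exists hM t) as (P & Hseq & HP).
  assert (Hnth : forall n, is_nat n -> nth_problem P n A A delta).
  { intros n Hn. exists t. split; [now apply HP | exact Ht]. }
  destruct (H P) as (f & Hf & Hin & Hst).
  { split; [exact Hseq|split].
    - intros n Hn. exists A, A, delta. auto.
    - intros n m i s sigma i' s' sigma' Hn Hm K K'.
      pose proof (nat_succ hM _ _ Hn Hm) as Hn'.
      destruct (nth_problem_unique hM _ _ _ _ _ _ _ _ Hseq Hn K (Hnth n Hn))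
        as (_ & -> & _).
      now destruct
        (nth_problem_unique hM _ _ _ _ _ _ _ _ Hseq Hn' K' (Hnth m Hn'))
        as (-> & _). }
  exists f. split; [exact Hf|split].
  - intros n x Hn Hx. exact (Hin n A A delta x Hn (Hnth n Hn) Hx).
  - intros n m x y Hn Hm Hx Hy.
    exact (Hst n m A A delta x y Hn Hm (Hnth n Hn) Hx Hy).
Qed.

Theorem theorem3p19 (M : set_structure) (hM : models_ZF M) :
  (DC M <-> chains_solvable_from_each_instance M) /\
  (chains_solvable_from_each_instance M <-> chains_solvable M).
Proof.
  pose proof (chains_solvable_from_each_instance_of_DC hM).
  pose proof (chains_solvable_of_each_instance hM).
  pose proof (DC_of_chains_solvable hM).
  tauto.
Qed.
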